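(* Let $T$ be a $4$-ball tetrahedron and let $\Sigma_T$ be its dihedral angle sum. Then $$6\arccos\tfrac13 \le \Sigma_T < 3\pi,$$ and each value in the interval $[6\arccos\tfrac13, 3\pi)$ is attained as $\Sigma_T$ for some $4$-ball tetrahedron $T$.
   Context: A tetrahedron is the convex hull of four points in $\mathbb{R}^3$ not lying in the same plane. The six interior angles between its faces are called its dihedral angles (each dihedral angle is associated with one of the six edges). The dihedral angle sum $\Sigma_T$ of a tetrahedron $T$ is the sum of all its six dihedral angles (in radians). A tetrahedron $T$ is called a $4$-ball tetrahedron if there exists a sphere tangent to all six edges of $T$, where the edges are the closed line segments joining pairs of vertices (so the sphere touches each edge segment); such a sphere is called a mid-sphere of $T$. *)

(* Defs.v *)
From HB Require Import structures.
From mathcomp Require Import all_boot all_order all_algebra.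
From mathcomp Require Import all_classical all_reals all_analysis.

Set Implicit Arguments.
Unset Strict Implicit.
Unset Printing Implicit Defensive.

Import Order.TTheory GRing.Theory Num.Theory.
Local Open Scope classical_set_scope.
Local Open Scope ring_scope.

Section Euclidean3.
Variable R : realType.
Implicit Types (A B C D O u v w x : 'rV[R]_3).

Definition dot u v : R := \sum_(i < 3) u 0 i * v 0 i.

(* The library norm on row vectors is the sup norm, not the Euclidean one. *)
Definition enorm u : R := Num.sqrt (dot u u).

(* Only meaningful for nonzero u and v. *)
Definition vangle u v : R := acos (dot u v / (enorm u * enorm v)).

Definition orth_part w u := u - (dot u w / dot w w) *: w.

Definition line A B : set 'rV[R]_3 := [set A + t *: (B - A) | t in setT].

Definition closed_segment A B : set 'rV[R]_3 :=
  [set A + t *: (B - A) | t in `[0, 1]].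

Definition sphere O (r : R) : set 'rV[R]_3 := [set x | enorm (x - O) = r].

(* The second conjunct says that the line AB is tangent to the sphere at x. *)
Definition sphere_tangent_to_edge O (r : R) A B :=
  exists x, closed_segment A B x /\ line A B `&` sphere O r = [set x].

(* A tetrahedron is given by its four vertices A, B, C, D. *)

Definition coplanar A B C D :=
  exists w, w != 0 /\ exists k : R,
    [/\ dot w A = k, dot w B = k, dot w C = k & dot w D = k].

Definition is_tetrahedron A B C D := ~ coplanar A B C D.

(* Interior angle at the edge AB: the faces ABC and ABD leave that edge
   perpendicularly in the directions of the parts of C - A and D - A
   orthogonal to B - A. *)
Definition dihedral_angle A B C D : R :=
  vangle (orth_part (B - A) (C - A)) (orth_part (B - A) (D - A)).

Definition dihedral_angle_sum A B C D : R :=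
  dihedral_angle A B C D + dihedral_angle A C B D + dihedral_angle A D B C
  + dihedral_angle B C A D + dihedral_angle B D A C + dihedral_angle C D A B.

Definition is_midsphere O (r : R) A B C D :=
  0 < r /\
  [/\ sphere_tangent_to_edge O r A B, sphere_tangent_to_edge O r A C
    & sphere_tangent_to_edge O r A D] /\
  [/\ sphere_tangent_to_edge O r B C, sphere_tangent_to_edge O r B D
    & sphere_tangent_to_edge O r C D].

Definition is_4ball_tetrahedron A B C D :=
  is_tetrahedron A B C D /\ exists O r, is_midsphere O r A B C D.

End Euclidean3.

(* Main.v *)
Require Import Defs.
From mathcomp Require Import all_boot all_order all_algebra.
From mathcomp Require Import all_classical all_reals all_analysis.
From mathcomp Require Import ring lra.

(** The vertices of a tetrahedron with a mid-sphere are the centres of four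
    mutually tangent balls: the tangent segments from a vertex to the sphere
    all have one length, so the edges are a + b, a + c, ..., c + d. Everything
    is expressed with the curvatures x, y, z, w (the inverse radii), their sum
    s, and n > 0 given by n^2 = s^2 - 2 (x^2 + y^2 + z^2 + w^2). The
    mid-sphere has radius 2 / n, and the tetrahedron is nondegenerate exactly
    when that expression is positive, being a Gram determinant up to a square
    factor.

    In the plane orthogonal to an edge at its tangency point, the centre of
    the sphere splits the dihedral angle into two signed angles, one for each
    face. Each of them depends only on the face, because the distance from the
    tangency point to the foot of the centre on the face is the inradius of
    that face. For the face opposite to the vertex of curvature x the angle is
    atan ((s - 2 x) / n), here called a tilt ([dihedral_angle_tilt]). Every
    face has three edges, so the dihedral angle sum is three times the sum phi
    of the four tilts ([dihedral_angle_sum_tilt]).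

    Writing e1, e3, e4 for the elementary symmetric functions of the
    curvatures, the addition formulas give sin phi and cos phi, up to one
    positive factor, as n e3 and - (e1 e3 - 2 e4). Positivity of the sine
    yields phi < pi, which is the upper bound. The lower bound
    phi >= 2 acos (1/3) amounts to cos phi <= - 7/9, hence to
    49 n^2 e3^2 <= 32 (e1 e3 - 2 e4)^2 ([curvature_ineq]), and this follows
    from a Newton inequality and a quartic inequality between symmetric
    functions ([quartic_ineq]).

    All values are attained with curvatures in two equal pairs, on two
    opposite edges. The tilts are then atan k and atan (1 / (2k)), each twice,
    for an arbitrary k > 0 ([balanced_tetrahedron]), and
    tan (atan k + atan (1 / (2k))) = 2 k + 1 / k takes every value from
    2 sqrt 2 = tan (acos (1/3)) on. Solving a quadratic equation for k replaces a
    continuity argument ([atan_family]). *)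

Import Order.TTheory GRing.Theory Num.Theory.
Local Open Scope ring_scope.

Set Implicit Arguments.
Unset Strict Implicit.
Unset Printing Implicit Defensive.

(** * Inequalities between symmetric functions *)

Section SymmetricFunctions.
Variable R : realType.
Implicit Types a b c d x y z w : R.

(** In monomial symmetric sums the right-hand side is
    5 m31 + 10 m22 - 7 m211 - 36 m1111. It is a combination, with nonnegative
    coefficients, of squares of differences between two variables or between
    two products of two variables. *)
Lemma quartic_ineq a b c d : 0 < a -> 0 < b -> 0 < c -> 0 < d ->
  0 <= 5 * (a + b + c + d) ^+ 2 * (a * b + a * c + a * d + b * c + b * d + c * d)
   - 32 * (a + b + c + d) * (a * b * c + a * b * d + a * c * d + b * c * d)
   + 32 * (a * b * c * d).
Proof.
move=> ha hb hc hd.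
have term (u v : R) : 0 < u -> 0 < v -> 0 <= u * v * (u - v) ^+ 2.
  by move=> hu hv; apply: mulr_ge0; [exact: ltW (mulr_gt0 hu hv) | exact: sqr_ge0].
have sos : 0 <= 5 * (a * b * (a - b) ^+ 2 + a * c * (a - c) ^+ 2
     + a * d * (a - d) ^+ 2 + b * c * (b - c) ^+ 2 + b * d * (b - d) ^+ 2
     + c * d * (c - d) ^+ 2)
  + 6 * ((a * b - c * d) ^+ 2 + (a * c - b * d) ^+ 2 + (a * d - b * c) ^+ 2)
  + 7 / 2 * (a ^+ 2 * ((b - c) ^+ 2 + (b - d) ^+ 2 + (c - d) ^+ 2)
     + b ^+ 2 * ((a - c) ^+ 2 + (a - d) ^+ 2 + (c - d) ^+ 2)
     + c ^+ 2 * ((a - b) ^+ 2 + (a - d) ^+ 2 + (b - d) ^+ 2)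
     + d ^+ 2 * ((a - b) ^+ 2 + (a - c) ^+ 2 + (b - c) ^+ 2)).
  by rewrite !(addr_ge0, term, sqr_ge0, mulr_ge0, invr_ge0, ler0n).
apply: le_trans sos _; rewrite le_eqVlt; apply/orP; left; apply/eqP.
by field.
Qed.

(** Newton's inequality 8 e2 <= 3 e1^2 bounds the factor e1^2 - 2 (x^2 + ...) =
    4 e2 - e1^2 by 4/3 e2. After that the claim becomes
    5 e2 e3^2 - 32 e1 e3 e4 + 32 e4^2 >= 0, which is the quartic inequality for
    the four products of three curvatures, divided by e4. Equality holds when
    the curvatures are equal, which is why the constants 49 and 32 fit the
    regular tetrahedron. *)
Lemma curvature_ineq x y z w : 0 < x -> 0 < y -> 0 < z -> 0 < w ->
  49 * ((x + y + z + w) ^+ 2 - 2 * (x ^+ 2 + y ^+ 2 + z ^+ 2 + w ^+ 2))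
     * (x * y * z + x * y * w + x * z * w + y * z * w) ^+ 2
  <= 32 * ((x + y + z + w) * (x * y * z + x * y * w + x * z * w + y * z * w)
           - 2 * (x * y * z * w)) ^+ 2.
Proof.
move=> hx hy hz hw.
set e1 := x + y + z + w.
set e3 := x * y * z + x * y * w + x * z * w + y * z * w.
set e2 := x * y + x * z + x * w + y * z + y * w + z * w.
set e4 := x * y * z * w.
have e4_gt0 : 0 < e4 by rewrite !mulr_gt0.
have newton : 8 * e2 <= 3 * e1 ^+ 2.
  have -> : 3 * e1 ^+ 2 = 8 * e2 + ((x - y) ^+ 2 + (x - z) ^+ 2 + (x - w) ^+ 2
    + (y - z) ^+ 2 + (y - w) ^+ 2 + (z - w) ^+ 2) by rewrite /e1 /e2; ring.
  by rewrite lerDl !addr_ge0 // sqr_ge0.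
have quartic : 0 <= 5 * e2 * e3 ^+ 2 - 32 * e1 * e3 * e4 + 32 * e4 ^+ 2.
  rewrite -(pmulr_rge0 _ e4_gt0).
  have h3 (a b c : R) : 0 < a -> 0 < b -> 0 < c -> 0 < a * b * c.
    by move=> *; rewrite !mulr_gt0.
  apply: le_trans (quartic_ineq (h3 _ _ _ hy hz hw) (h3 _ _ _ hx hz hw)
    (h3 _ _ _ hx hy hw) (h3 _ _ _ hx hy hz)) _.
  by rewrite le_eqVlt; apply/orP; left; apply/eqP; rewrite /e1 /e2 /e3 /e4; ring.
have -> : e1 ^+ 2 - 2 * (x ^+ 2 + y ^+ 2 + z ^+ 2 + w ^+ 2) = 4 * e2 - e1 ^+ 2.
  by rewrite /e1 /e2; ring.
have e3sq : 0 <= e3 ^+ 2 by exact: sqr_ge0.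
have := mulr_ge0 e3sq (_ : 0 <= 3 * e1 ^+ 2 - 8 * e2).
rewrite subr_ge0 => /(_ newton); nra.
Qed.

End SymmetricFunctions.

(** * Scalar product and Gram determinant *)

Section EuclideanGeometry.
Variable R : realType.
Implicit Types (u v w p A B C D O X : 'rV[R]_3) (r a b c d t : R).

Lemma dotE (u v : 'rV[R]_3) : dot u v =
  u 0 0 * v 0 0 + u 0 1 * v 0 1 + u 0 2%:R * v 0 2%:R.
Proof.
rewrite /dot !big_ord_recl big_ord0 addr0 addrA.
have e1 : lift ord0 ord0 = 1 :> 'I_3 by apply: val_inj.
have e2 : lift ord0 (lift ord0 ord0) = 2%:R :> 'I_3 by apply: val_inj.
by rewrite e1 e2.
Qed.

Lemma dotC (u v : 'rV[R]_3) : dot u v = dot v u.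
Proof. by rewrite !dotE; ring. Qed.

Lemma dotDl (u v w : 'rV[R]_3) : dot (u + v) w = dot u w + dot v w.
Proof. by rewrite !dotE !mxE; ring. Qed.

Lemma dotZl k (u w : 'rV[R]_3) : dot (k *: u) w = k * dot u w.
Proof. by rewrite !dotE !mxE; ring. Qed.

Lemma dotNl (u w : 'rV[R]_3) : dot (- u) w = - dot u w.
Proof. by rewrite !dotE !mxE; ring. Qed.

Lemma dotDr (u v w : 'rV[R]_3) : dot w (u + v) = dot w u + dot w v.
Proof. by rewrite !(dotC w) dotDl. Qed.

Lemma dotZr k (u w : 'rV[R]_3) : dot w (k *: u) = k * dot w u.
Proof. by rewrite !(dotC w) dotZl. Qed.

Lemma dotNr (u w : 'rV[R]_3) : dot w (- u) = - dot w u.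
Proof. by rewrite !(dotC w) dotNl. Qed.

Lemma dot_ge0 (u : 'rV[R]_3) : 0 <= dot u u.
Proof. by apply: sumr_ge0 => i _; rewrite -expr2 sqr_ge0. Qed.

Lemma dot_eq0 (u : 'rV[R]_3) : dot u u = 0 -> u = 0.
Proof.
move/eqP; rewrite psumr_eq0 => [/allP h|i _]; last by rewrite -expr2 sqr_ge0.
apply/rowP => i; have := h i (mem_index_enum _); rewrite mxE.
by rewrite mulf_eq0 orbb => /eqP.
Qed.

Lemma dot_orth_part (w u v : 'rV[R]_3) : dot w w != 0 ->
  dot (orth_part w u) (orth_part w v) = dot u v - dot u w * dot v w / dot w w.
Proof.
move=> w0; rewrite /orth_part !(dotDl, dotNl, dotZl, dotDr, dotNr, dotZr).
by rewrite (dotC w v); field.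
Qed.

Lemma enorm_eq (u : 'rV[R]_3) (r : R) : 0 <= r ->
  enorm u = r <-> dot u u = r ^+ 2.
Proof.
move=> r0; split=> [<-|uu]; first by rewrite sqr_sqrtr ?dot_ge0.
by rewrite /enorm uu sqrtr_sqr ger0_norm.
Qed.

Lemma det33 (M : 'M[R]_3) : \det M =
  M 0 0 * (M 1 1 * M 2%:R 2%:R - M 1 2%:R * M 2%:R 1)
  - M 0 1 * (M 1 0 * M 2%:R 2%:R - M 1 2%:R * M 2%:R 0)
  + M 0 2%:R * (M 1 0 * M 2%:R 1 - M 1 1 * M 2%:R 0).
Proof.
pose f i j := M (inord i) (inord j).
have E i j : M i j = f i j by rewrite /f !inord_val.
rewrite (expand_det_row _ 0) !big_ord_recl big_ord0 /cofactor.
rewrite !(expand_det_row _ 0) !big_ord_recl !big_ord0 /cofactor !det_mx11 !mxE.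
rewrite !E /= /bump /=; ring.
Qed.

(** The Gram determinant of three vectors is the square of their determinant,
    which vanishes only if some nonzero vector is orthogonal to all three. *)
Lemma gram_gt0 (u v w : 'rV[R]_3) :
  (forall p : 'rV[R]_3, dot p u = 0 -> dot p v = 0 -> dot p w = 0 -> p = 0) ->
  0 < dot u u * dot v v * dot w w + 2 * dot u v * dot v w * dot u w
      - dot u u * dot v w ^+ 2 - dot v v * dot u w ^+ 2 - dot w w * dot u v ^+ 2.
Proof.
move=> indep.
pose M : 'M[R]_3 := \matrix_(i, j) nth 0 [:: u 0 i; v 0 i; w 0 i] j.
have pM (p : 'rV[R]_3) j : (p *m M) 0 j = nth 0 [:: dot p u; dot p v; dot p w] j.
  rewrite mxE /dot; case: j => -[|[|[|//]]] hj /=;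
  by apply: eq_bigr => i _; rewrite mxE.
have detM : \det M != 0.
  apply/negP => /det0P [p p0 pM0]; move/eqP: p0; apply; apply: indep.
  - by have := pM p 0; rewrite pM0 mxE.
  - by have := pM p 1; rewrite pM0 mxE.
  - by have := pM p 2%:R; rewrite pM0 mxE.
have : 0 < \det M ^+ 2 by rewrite exprn_even_gt0.
suff -> : \det M ^+ 2 = dot u u * dot v v * dot w w
  + 2 * dot u v * dot v w * dot u w
  - dot u u * dot v w ^+ 2 - dot v v * dot u w ^+ 2 - dot w w * dot u v ^+ 2 by [].
rewrite det33 !mxE /= !dotE; ring.
Qed.

Definition sqdist A B : R := dot (B - A) (B - A).

Lemma sqdistxx A : sqdist A A = 0.
Proof. by rewrite /sqdist subrr dotE !mxE mulr0 !addr0. Qed.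

Lemma sqdistC A B : sqdist A B = sqdist B A.
Proof. by rewrite /sqdist -opprB dotNl dotNr opprK. Qed.

Lemma dot_polar (A B C : 'rV[R]_3) :
  dot (B - A) (C - A) = (sqdist A B + sqdist A C - sqdist B C) / 2.
Proof. by rewrite /sqdist !dotE !mxE; field. Qed.

(** * Tangent segments from the vertices to the mid-sphere *)

Lemma sqdist_on_line (A B O : 'rV[R]_3) (t s : R) :
  dot (A + s *: (B - A) - O) (A + s *: (B - A) - O)
    = dot (A + t *: (B - A) - O) (A + t *: (B - A) - O)
      + 2 * (s - t) * dot (B - A) (A + t *: (B - A) - O)
      + (s - t) ^+ 2 * sqdist A B.
Proof. by rewrite /sqdist !dotE !mxE; ring. Qed.

(** The squared distance to O is a quadratic polynomial along the line. If the
    sphere contained a second point, reflected through the foot of the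
    perpendicular from O, the intersection would not be a single point; so the
    tangency point is that foot, and Pythagoras applies at both ends. *)
Lemma tangent_edge_dist (A B O : 'rV[R]_3) (r : R) : 0 < r ->
  sphere_tangent_to_edge O r A B ->
  exists2 t, 0 <= t <= 1 &
   sqdist O A = r ^+ 2 + t ^+ 2 * sqdist A B /\
   sqdist O B = r ^+ 2 + (1 - t) ^+ 2 * sqdist A B.
Proof.
move=> r0 [_ [[t t01 <-] meet]].
set X := A + t *: (B - A) in meet *.
have Xr : dot (X - O) (X - O) = r ^+ 2.
  have : [set X]%classic X by [].
  by rewrite -meet => -[_ /= /enorm_eq ->] //; exact: ltW.
have foot : dot (B - A) (X - O) = 0.
  have [->|AB] := eqVneq (B - A) 0; first by rewrite dotE !mxE !mul0r !addr0.
  have AB0 : sqdist A B != 0 by apply: contraNneq AB => /dot_eq0 ->.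
  pose s := t - 2 * dot (B - A) (X - O) / sqdist A B.
  have : [set X]%classic (A + s *: (B - A)).
    rewrite -meet; split; first by exists s.
    apply/enorm_eq; first exact: ltW.
    by rewrite (sqdist_on_line A B O t s) -/X Xr /s; field.
  move=> /= /addrI /eqP; rewrite -subr_eq0 -scalerBl scaler_eq0 => /orP[|].
    move=> /eqP st; have -> : dot (B - A) (X - O) = - (s - t) * sqdist A B / 2.
      by rewrite /s; field.
    by rewrite st oppr0 !mul0r.
  by rewrite (negbTE AB).
exists t; first by move: t01; rewrite /= in_itv.
have := sqdist_on_line A B O t 0; have := sqdist_on_line A B O t 1.
rewrite -/X foot Xr scale0r scale1r addr0 (addrC A) subrK /sqdist => -> ->.
by split; ring.
Qed.

(** The two tangent segments add up to the edge because the tangency point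
    lies on the closed segment. *)
Lemma tangency_lengths (A B O : 'rV[R]_3) (r : R) : 0 < r ->
  sphere_tangent_to_edge O r A B ->
  sqdist A B = (Num.sqrt (sqdist O A - r ^+ 2)
                + Num.sqrt (sqdist O B - r ^+ 2)) ^+ 2.
Proof.
move=> r0 /(tangent_edge_dist r0) [t /andP[t0 t1] [OA OB]].
have AB0 : 0 <= sqdist A B by exact: dot_ge0.
have t1' : 0 <= 1 - t by rewrite subr_ge0.
rewrite OA OB ![r ^+ 2 + _]addrC !addrK.
rewrite !(sqrtrM _ (sqr_ge0 _)) !sqrtr_sqr !ger0_norm // -mulrDl addrC subrK mul1r.
by rewrite sqr_sqrtr.
Qed.

(** Conversely, when the tangent lengths a and b add up to the length of the
    edge, the point at distance a from A is the foot of the perpendicular. *)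
Lemma tangent_edgeP (A B O : 'rV[R]_3) (r a b : R) : 0 < r -> 0 < a -> 0 < b ->
  sqdist A B = (a + b) ^+ 2 ->
  sqdist O A = r ^+ 2 + a ^+ 2 -> sqdist O B = r ^+ 2 + b ^+ 2 ->
  sphere_tangent_to_edge O r A B.
Proof.
move=> r0 a0 b0 AB OA OB.
have ab : a + b != 0 by rewrite gt_eqF ?addr_gt0.
pose t := a / (a + b); pose X := A + t *: (B - A).
have PO : dot (B - A) (A - O) = - a * (a + b).
  have := dot_polar A B O; rewrite (sqdistC A O) (sqdistC B O) AB OA OB.
  by rewrite -(opprB A O) dotNr => /eqP; rewrite eqr_oppLR => /eqP ->; field.
have foot : dot (B - A) (X - O) = 0.
  by rewrite /X addrAC dotDr dotZr PO -/(sqdist A B) AB /t; field.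
have Xr : dot (X - O) (X - O) = r ^+ 2.
  rewrite (sqdist_on_line A B O 0 t) scale0r addr0 PO -/(sqdist O A) AB OA /t.
  by field.
exists X; split.
  exists t => //; rewrite /= in_itv /= divr_ge0 ?ler_pdivrMr ?mul1r ?lerDl //.
  - exact: ltW.
  - exact: addr_gt0.
  - by rewrite ltW.
  - by rewrite ltW // addr_gt0.
apply/seteqP; split=> Y /=.
  case=> -[s _ <-] /enorm_eq YO; have {}YO := YO (ltW r0).
  have := sqdist_on_line A B O t s; rewrite -/X foot Xr YO AB mulr0 addr0.
  move/eqP; rewrite -[X in X == _]addr0 eq_sym (inj_eq (addrI _)) mulf_eq0.
  by rewrite !sqrf_eq0 (negbTE ab) orbF subr_eq0 => /eqP ->.
by move=> ->; split; [exists t | apply/enorm_eq => //; exact: ltW].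
Qed.

(** The balls of radii a, b, c, d centred at the vertices touch pairwise. *)
Definition mutually_tangent A B C D a b c d : Prop :=
  [/\ sqdist A B = (a + b) ^+ 2, sqdist A C = (a + c) ^+ 2
    & sqdist A D = (a + d) ^+ 2] /\
  [/\ sqdist B C = (b + c) ^+ 2, sqdist B D = (b + d) ^+ 2
    & sqdist C D = (c + d) ^+ 2].

Lemma midsphere_tangent A B C D O r : is_midsphere O r A B C D ->
  let rad X := Num.sqrt (sqdist O X - r ^+ 2) in
  mutually_tangent A B C D (rad A) (rad B) (rad C) (rad D).
Proof.
move=> [r0 [[AB AC AD] [BC BD CD]]] rad.
by split; split; apply: tangency_lengths r0 _.
Qed.

(** The right-hand side is one quarter of the Gram determinant of the three
    edges at A. Divided by (a b c d)^2 it is the quantity n^2 of the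
    curvatures. *)
Lemma mutually_tangent_gram A B C D a b c d :
  mutually_tangent A B C D a b c d ->
  ~ coplanar A B C D ->
  0 < 2 * (a * b * (c * d) ^+ 2 + a * c * (b * d) ^+ 2 + a * d * (b * c) ^+ 2
         + b * c * (a * d) ^+ 2 + b * d * (a * c) ^+ 2 + c * d * (a * b) ^+ 2)
   - ((a * b * c) ^+ 2 + (a * b * d) ^+ 2 + (a * c * d) ^+ 2 + (b * c * d) ^+ 2).
Proof.
move=> [[AB AC AD] [BC BD CD]] ncop.
have := @gram_gt0 (B - A) (C - A) (D - A); rewrite !dot_polar.
rewrite AB AC AD BC BD CD !sqdistxx => gram.
rewrite -(pmulr_rgt0 _ (ltr0n R 4)).
apply: lt_le_trans (gram _) _; last first.
  by rewrite le_eqVlt; apply/orP; left; apply/eqP; field.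
move=> p pAB pAC pAD; apply: contrapT => /eqP p0; apply: ncop; exists p.
split=> //; exists (dot p A).
move: pAB pAC pAD; rewrite !dotDr !dotNr => /eqP + /eqP + /eqP.
by rewrite !subr_eq0 => /eqP -> /eqP -> /eqP ->.
Qed.

(** When one radius vanishes, the quarter Gram determinant becomes minus a
    square; so its positivity turns nonnegative radii into positive ones. A
    vertex therefore never lies on the mid-sphere. *)
Lemma radii_gt0 (a b c d : R) : 0 <= a -> 0 <= b -> 0 <= c -> 0 <= d ->
  0 < 2 * (a * b * (c * d) ^+ 2 + a * c * (b * d) ^+ 2 + a * d * (b * c) ^+ 2
         + b * c * (a * d) ^+ 2 + b * d * (a * c) ^+ 2 + c * d * (a * b) ^+ 2)
   - ((a * b * c) ^+ 2 + (a * b * d) ^+ 2 + (a * c * d) ^+ 2 + (b * c * d) ^+ 2) ->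
  [/\ 0 < a, 0 < b, 0 < c & 0 < d].
Proof.
have sq (u : R) : (0 < - u ^+ 2) = false by rewrite oppr_gt0 ltNge sqr_ge0.
rewrite !le0r => /orP[/eqP->|->] /orP[/eqP->|->] /orP[/eqP->|->] /orP[/eqP->|->] //;
by rewrite !(mul0r, mulr0, expr0n, addr0, add0r, sub0r) /= ?sq ?oppr0 ?ltxx.
Qed.

End EuclideanGeometry.

(** * Dihedral angles as sums of two tilts *)

Section DihedralAngles.
Variable R : realType.
Implicit Types a b c d x y z w n s t u : R.

Lemma cos_atan_gt0 t : 0 < cos (atan t).
Proof. by rewrite cos_gt0_pihalf // atan_gtNpi2 atan_ltpi2. Qed.

Lemma sin_atanE t : sin (atan t) = t * cos (atan t).
Proof. by rewrite -{2}(atanK t) /tan divfK // gt_eqF // cos_atan_gt0. Qed.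

Lemma atanD_bounds t u : 0 < t + u -> 0 < atan t + atan u < pi.
Proof.
move=> tu; apply/andP; split.
  by rewrite -ltrBlDr sub0r -atanN lt_atan // -subr_gt0 opprK.
have := atan_ltpi2 t; have := atan_ltpi2 u; lra.
Qed.

(** Signed angle, seen from any edge of a face, between that face and the
    centre of the mid-sphere; x is the curvature at the vertex opposite to the
    face. It is negative when the centre lies beyond the face. *)
Definition tilt n s x : R := atan ((s - 2 * x) / n).

(** In the plane orthogonal to AB, measured from the direction of the centre
    of the mid-sphere, the parts of C - A and D - A orthogonal to B - A are
    (L / z) (1, tw) and (L / w) (1, - tz), where L = n / (x + y) and tz, tw
    are the tangents of the tilts of the faces ABD and ABC. The angle between
    these two vectors is atan tw + atan tz. The scalar products are computed
    from the edge lengths alone. *)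
Lemma dihedral_angle_tilt (A B C D : 'rV[R]_3) x y z w n s :
  0 < x -> 0 < y -> 0 < z -> 0 < w -> 0 < n ->
  s = x + y + z + w ->
  n ^+ 2 = s ^+ 2 - 2 * (x ^+ 2 + y ^+ 2 + z ^+ 2 + w ^+ 2) ->
  mutually_tangent A B C D x^-1 y^-1 z^-1 w^-1 ->
  dihedral_angle A B C D = tilt n s z + tilt n s w.
Proof.
move=> x0 y0 z0 w0 n0 sE nE [[AB AC AD] [BC BD CD]].
have xy0 : 0 < x + y by exact: addr_gt0.
have := (gt_eqF x0, gt_eqF y0, gt_eqF z0, (gt_eqF w0, gt_eqF n0, gt_eqF xy0)).
move=> [[[/negbT nx /negbT ny] /negbT nz] [[/negbT nw /negbT nn] /negbT nxy]].
have nxy2 : (y + x) ^+ 2 + (y + x) ^+ 2 != 0.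
  by rewrite gt_eqF // addr_gt0 // exprn_gt0 // addrC.
set tz := (s - 2 * z) / n; set tw := (s - 2 * w) / n.
pose L := n / (x + y).
have PP : dot (B - A) (B - A) != 0.
  by rewrite -/(sqdist A B) AB expf_neq0 // gt_eqF // addr_gt0 ?invr_gt0.
have uu : dot (orth_part (B - A) (C - A)) (orth_part (B - A) (C - A))
    = (L / z) ^+ 2 * (1 + tw ^+ 2).
  have -> : (L / z) ^+ 2 * (1 + tw ^+ 2)
      = (n ^+ 2 + (s - 2 * w) ^+ 2) / ((x + y) * z) ^+ 2.
    by rewrite /L /tw; field; rewrite nxy nz.
  rewrite dot_orth_part // !dot_polar !sqdistxx (sqdistC C B) AB AC BC nE sE; field.
  by rewrite nxy2 nx ny nz nxy.
have vv : dot (orth_part (B - A) (D - A)) (orth_part (B - A) (D - A))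
    = (L / w) ^+ 2 * (1 + tz ^+ 2).
  have -> : (L / w) ^+ 2 * (1 + tz ^+ 2)
      = (n ^+ 2 + (s - 2 * z) ^+ 2) / ((x + y) * w) ^+ 2.
    by rewrite /L /tz; field; rewrite nxy nw.
  rewrite dot_orth_part // !dot_polar !sqdistxx (sqdistC D B) AB AD BD nE sE; field.
  by rewrite nxy2 nx ny nw nxy.
have uv : dot (orth_part (B - A) (C - A)) (orth_part (B - A) (D - A))
    = (L / z) * (L / w) * (1 - tz * tw).
  have -> : (L / z) * (L / w) * (1 - tz * tw)
      = (n ^+ 2 - (s - 2 * z) * (s - 2 * w)) / ((x + y) ^+ 2 * z * w).
    by rewrite /L /tz /tw; field; rewrite nxy nz nw.
  rewrite dot_orth_part // !dot_polar !sqdistxx (sqdistC C B) (sqdistC D B).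
  rewrite AB AC AD BC BD CD nE sE; field.
  by rewrite nxy2 nx ny nz nw nxy.
have L0 : 0 < L by exact: divr_gt0.
rewrite /dihedral_angle /vangle /enorm uu vv uv.
rewrite !(sqrtrM _ (sqr_ge0 _)) !sqrtr_sqr !gtr0_norm ?divr_gt0 //.
rewrite /tilt -/tz -/tw.
have -> : L / z * (L / w) * (1 - tz * tw) / (L / z * Num.sqrt (1 + tw ^+ 2) *
   (L / w * Num.sqrt (1 + tz ^+ 2))) = cos (atan tz + atan tw).
  rewrite cosD !sin_atanE !cos_atan.
  have sq0 t : Num.sqrt (1 + t ^+ 2) != 0.
    by rewrite gt_eqF // sqrtr_gt0 ltr_wpDr ?sqr_ge0.
  by field; rewrite !sq0 nz nw gt_eqF.
rewrite cosK // in_itv /=.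
have /atanD_bounds/andP[/ltW -> /ltW -> //] : 0 < tz + tw.
have -> : tz + tw = 2 * (x + y) / n by rewrite /tz /tw sE; field.
by rewrite divr_gt0 // mulr_gt0.
Qed.

(** Each tilt occurs in the three edges of its face. *)
Lemma dihedral_angle_sum_tilt (A B C D : 'rV[R]_3) x y z w n s :
  0 < x -> 0 < y -> 0 < z -> 0 < w -> 0 < n ->
  s = x + y + z + w ->
  n ^+ 2 = s ^+ 2 - 2 * (x ^+ 2 + y ^+ 2 + z ^+ 2 + w ^+ 2) ->
  mutually_tangent A B C D x^-1 y^-1 z^-1 w^-1 ->
  dihedral_angle_sum A B C D
    = 3 * (tilt n s x + tilt n s y + tilt n s z + tilt n s w).
Proof.
move=> x0 y0 z0 w0 n0 sE nE tangent.
have ang (A' B' C' D' : 'rV[R]_3) x' y' z' w' :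
    0 < x' -> 0 < y' -> 0 < z' -> 0 < w' ->
    x' + y' + z' + w' = x + y + z + w ->
    x' ^+ 2 + y' ^+ 2 + z' ^+ 2 + w' ^+ 2 = x ^+ 2 + y ^+ 2 + z ^+ 2 + w ^+ 2 ->
    mutually_tangent A' B' C' D' x'^-1 y'^-1 z'^-1 w'^-1 ->
    dihedral_angle A' B' C' D' = tilt n s z' + tilt n s w'.
  move=> x'0 y'0 z'0 w'0 sumE sqE tangent'.
  by apply: (dihedral_angle_tilt x'0 y'0 z'0 w'0 n0 _ _ tangent');
    rewrite ?sumE ?sqE.
have [[AB AC AD] [BC BD CD]] := tangent.
rewrite /dihedral_angle_sum (ang A B C D x y z w) //.
rewrite (ang A C B D x z y w) //; [|ring|ring|]; last first.
  by split; split=> //; rewrite sqdistC addrC.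
rewrite (ang A D B C x w y z) //; [|ring|ring|]; last first.
  by split; split=> //; rewrite sqdistC addrC.
rewrite (ang B C A D y z x w) //; [|ring|ring|]; last first.
  by split; split=> //; rewrite sqdistC addrC.
rewrite (ang B D A C y w x z) //; [|ring|ring|]; last first.
  by split; split=> //; rewrite sqdistC addrC.
rewrite (ang C D A B z w x y) //; [|ring|ring|]; last first.
  by split; split=> //; rewrite sqdistC addrC.
ring.
Qed.

(** * Bounds for the sum of the four tilts *)

Lemma cos_sum4_atan a b c d :
  cos (atan a + atan b + atan c + atan d)
    = cos (atan a) * cos (atan b) * cos (atan c) * cos (atan d)
      * (1 - (a * b + a * c + a * d + b * c + b * d + c * d) + a * b * c * d).
Proof. by rewrite !(cosD, sinD) !sin_atanE; ring. Qed.

Lemma sin_sum4_atan a b c d :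
  sin (atan a + atan b + atan c + atan d)
    = cos (atan a) * cos (atan b) * cos (atan c) * cos (atan d)
      * (a + b + c + d - (a * b * c + a * b * d + a * c * d + b * c * d)).
Proof. by rewrite !(cosD, sinD) !sin_atanE; ring. Qed.

(** Up to the positive factor K, sin phi is n e3 and cos phi is - q, where
    q = e1 e3 - 2 e4. *)
Lemma tilt_sum_bounds x y z w n s :
  0 < x -> 0 < y -> 0 < z -> 0 < w -> 0 < n ->
  s = x + y + z + w ->
  n ^+ 2 = s ^+ 2 - 2 * (x ^+ 2 + y ^+ 2 + z ^+ 2 + w ^+ 2) ->
  2 * acos (1 / 3) <= tilt n s x + tilt n s y + tilt n s z + tilt n s w < pi.
Proof.
move=> x0 y0 z0 w0 n0 sE nE; rewrite /tilt.
set a := (s - 2 * x) / n; set b := (s - 2 * y) / n.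
set c := (s - 2 * z) / n; set d := (s - 2 * w) / n.
set phi := _ + _ + _ + _.
pose e3 := x * y * z + x * y * w + x * z * w + y * z * w.
have e3_gt0 : 0 < e3 by rewrite !addr_gt0 ?mulr_gt0.
have nn : n != 0 by rewrite gt_eqF.
pose m := cos (atan a) * cos (atan b) * cos (atan c) * cos (atan d).
have m0 : 0 < m by rewrite !mulr_gt0 // cos_atan_gt0.
pose K := m * 8 / n ^+ 4.
have K0 : 0 < K by rewrite divr_gt0 ?exprn_gt0 // mulr_gt0.
have sinE : sin phi = K * (n * e3).
  rewrite sin_sum4_atan -/m.
  rewrite (_ : _ - _ = (2 * s * n ^+ 2 - ((s - 2 * x) * (s - 2 * y) * (s - 2 * z)
       + (s - 2 * x) * (s - 2 * y) * (s - 2 * w) + (s - 2 * x) * (s - 2 * z) * (s - 2 * w)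
       + (s - 2 * y) * (s - 2 * z) * (s - 2 * w))) / n ^+ 3); last first.
    by rewrite /a /b /c /d sE; field.
  rewrite (_ : _ - _ = 8 * e3); last by rewrite nE sE /e3; ring.
  by rewrite /K; field.
pose q := s * e3 - 2 * (x * y * z * w).
have cosE : cos phi = - (K * q).
  rewrite cos_sum4_atan -/m.
  rewrite (_ : 1 - _ + _ = (n ^+ 2 * n ^+ 2 - n ^+ 2 *
        ((s - 2 * x) * (s - 2 * y) + (s - 2 * x) * (s - 2 * z)
       + (s - 2 * x) * (s - 2 * w) + (s - 2 * y) * (s - 2 * z)
       + (s - 2 * y) * (s - 2 * w) + (s - 2 * z) * (s - 2 * w))
       + (s - 2 * x) * (s - 2 * y) * (s - 2 * z) * (s - 2 * w)) / n ^+ 4); last first.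
    by rewrite /a /b /c /d; field.
  rewrite (_ : _ - _ + _ = - 8 * q); last by rewrite nE /q /e3 sE; ring.
  by rewrite /K; field.
have q0 : 0 < q.
  have -> : q = x * (x * y * z + x * y * w + x * z * w)
      + y * (x * y * z + x * y * w + y * z * w)
      + z * (x * y * z + x * z * w + y * z * w)
      + w * (x * y * w + x * z * w + y * z * w) + 2 * (x * y * z * w).
    by rewrite /q /e3 sE; ring.
  by do ?[exact: mulr_gt0 | apply: addr_gt0 | apply: mulr_gt0].
(* Two tilts always have a positive sum less than pi, being a dihedral angle;
   hence phi is less than 2 pi, and the sign of its sine decides phi < pi. *)
have phiE : 0 < phi < 2 * pi.
  have pairs u v : u + v < s -> 0 < atan ((s - 2 * u) / n) + atan ((s - 2 * v) / n) < pi.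
    move=> uv; apply: atanD_bounds.
    by rewrite -mulrDl divr_gt0 //; lra.
  have /pairs/andP[? ?] : x + y < s by rewrite sE; lra.
  have /pairs/andP[? ?] : z + w < s by rewrite sE; lra.
  rewrite /phi /a /b /c /d; apply/andP; split; lra.
have sin0 : 0 < sin phi by rewrite sinE (mulr_gt0 K0 (mulr_gt0 n0 e3_gt0)).
case/andP: phiE => phi0 phi2.
have phi_ltpi : phi < pi.
  rewrite ltNge; apply/negP => piphi.
  have : 0 <= sin (phi - pi) by apply: sin_ge0_pi; apply/andP; split; lra.
  have := sinDpi (phi - pi); rewrite subrK => /(congr1 -%R); rewrite opprK => <-.
  by rewrite oppr_ge0 leNgt sin0.
rewrite phi_ltpi andbT.
(* With sin^2 + cos^2 = 1, the ratio below says that cos^2 >= 49 / 81. *)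
have cos_le : cos phi <= - (7 / 9).
  have cos_lt0 : cos phi < 0 by rewrite cosE oppr_lt0 mulr_gt0.
  have ratio : 49 * sin phi ^+ 2 <= 32 * cos phi ^+ 2.
    rewrite sinE cosE sqrrN !(exprMn 2 K) (exprMn 2 n) nE.
    have := ler_wpM2l (ltW (exprn_gt0 2 K0)) (curvature_ineq x0 y0 z0 w0).
    by rewrite -sE -/e3 -/q; lra.
  have := cos2Dsin2 phi; nra.
rewrite leNgt; apply/negP => phi_lt.
(* Below 2 acos (1/3), the double angle formula would give cos phi > 2/9 - 1. *)
have third : -1 <= (1 / 3 : R) <= 1 by apply/andP; split; lra.
have : cos (acos (1 / 3 : R)) < cos (phi / 2).
  rewrite ltr_cos ?in_itv /= ?acos_ge0 ?acos_lepi //; first by lra.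
  by apply/andP; split; lra.
rewrite acosK ?in_itv //= => half.
have : cos phi = 2 * cos (phi / 2) ^+ 2 - 1.
  by rewrite {1}(splitr phi) cosD -!expr2 sin2cos2; ring.
nra.
Qed.

End DihedralAngles.

(** * Bounds and realization of the dihedral angle sum *)

Section FourBallTetrahedra.
Variable R : realType.

Lemma dihedral_angle_sum_bounds (A B C D : 'rV[R]_3) : is_4ball_tetrahedron A B C D ->
  6 * acos (1 / 3) <= dihedral_angle_sum A B C D < 3 * pi.
Proof.
move=> [tet [ O [r midsphere]]].
have tangent := midsphere_tangent midsphere; move: tangent => /=.
set a := Num.sqrt _; set b := Num.sqrt _; set c := Num.sqrt _; set d := Num.sqrt _.
have : [/\ 0 <= a, 0 <= b, 0 <= c & 0 <= d] by split; exact: sqrtr_ge0.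
move: a b c d => a b c d [a_ge0 b_ge0 c_ge0 d_ge0] tangent.
have gram := mutually_tangent_gram tangent tet.
have [a0 b0 c0 d0] := radii_gt0 a_ge0 b_ge0 c_ge0 d_ge0 gram.
pose s := a^-1 + b^-1 + c^-1 + d^-1.
pose N := s ^+ 2 - 2 * (a^-1 ^+ 2 + b^-1 ^+ 2 + c^-1 ^+ 2 + d^-1 ^+ 2).
have N0 : 0 < N.
  apply: lt_le_trans (divr_gt0 gram
    (exprn_gt0 2 (mulr_gt0 (mulr_gt0 a0 b0) (mulr_gt0 c0 d0)))) _.
  rewrite le_eqVlt; apply/orP; left; apply/eqP.
  by rewrite /N /s; field; rewrite !gt_eqF.
have nE : Num.sqrt N ^+ 2 = N by rewrite sqr_sqrtr // ltW.
have inv0 (u : R) : 0 < u -> 0 < u^-1 by rewrite invr_gt0.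
have /= := @tilt_sum_bounds R a^-1 b^-1 c^-1 d^-1 (Num.sqrt N) s (inv0 _ a0)
  (inv0 _ b0) (inv0 _ c0) (inv0 _ d0).
rewrite sqrtr_gt0 => /(_ N0 erefl nE).
rewrite (@dihedral_angle_sum_tilt _ A B C D a^-1 b^-1 c^-1 d^-1 (Num.sqrt N) s)
  ?invrK ?invr_gt0 ?sqrtr_gt0 //.
by move=> /andP[? ?]; apply/andP; split; lra.
Qed.

Definition vec (a b c : R) : 'rV[R]_3 := \row_i nth 0 [:: a; b; c] i.

Lemma sqdist_vec a b c a' b' c' : sqdist (vec a b c) (vec a' b' c')
  = (a' - a) ^+ 2 + (b' - b) ^+ 2 + (c' - c) ^+ 2.
Proof. by rewrite /sqdist dotE !mxE /= !expr2. Qed.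

(** AB and CD are opposite edges orthogonal to each other and to the axis
    through their midpoints; the mid-sphere has the segment between these
    midpoints as a diameter. The radii are 2 k^2 at A and B and 1 at C and D,
    and the distance 2 k between the two edges makes the balls touch. *)
Lemma balanced_tetrahedron (k : R) : 0 < k ->
  let A := vec (2 * k ^+ 2) 0 0 in let B := vec (- (2 * k ^+ 2)) 0 0 in
  let C := vec 0 1 (2 * k) in let D := vec 0 (- 1) (2 * k) in
  is_4ball_tetrahedron A B C D /\
  dihedral_angle_sum A B C D = 6 * (atan k + atan ((2 * k)^-1)).
Proof.
move=> k0 A B C D.
have kn : k != 0 by rewrite gt_eqF.
have kk0 : 0 < 2 * k ^+ 2 by rewrite mulr_gt0 // exprn_gt0.
have AB : sqdist A B = (2 * k ^+ 2 + 2 * k ^+ 2) ^+ 2 by rewrite sqdist_vec; ring.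
have AC : sqdist A C = (2 * k ^+ 2 + 1) ^+ 2 by rewrite sqdist_vec; ring.
have AD : sqdist A D = (2 * k ^+ 2 + 1) ^+ 2 by rewrite sqdist_vec; ring.
have BC : sqdist B C = (2 * k ^+ 2 + 1) ^+ 2 by rewrite sqdist_vec; ring.
have BD : sqdist B D = (2 * k ^+ 2 + 1) ^+ 2 by rewrite sqdist_vec; ring.
have CD : sqdist C D = (1 + 1) ^+ 2 by rewrite sqdist_vec; ring.
have tangent : mutually_tangent A B C D (2 * k ^+ 2) (2 * k ^+ 2) 1 1 by [].
split; last first.
  rewrite (@dihedral_angle_sum_tilt _ A B C D (2 * k ^+ 2)^-1 (2 * k ^+ 2)^-1 1 1
    (2 / k) (k ^- 2 + 2)) ?invrK ?invr1 ?invr_gt0 ?divr_gt0 //; try by field.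
  have -> : tilt (2 / k) (k ^- 2 + 2) (2 * k ^+ 2)^-1 = atan k.
    by rewrite /tilt; congr atan; field.
  have -> : tilt (2 / k) (k ^- 2 + 2) 1 = atan (2 * k)^-1.
    by rewrite /tilt; congr atan; field.
  ring.
split.
  move=> [p [p0 [m]]]; rewrite !dotE !mxE /= => -[pA pB pC pD].
  have p_0 : p 0 0 * (2 * k ^+ 2) = 0 by lra.
  have p_1 : p 0 1 = 0 by lra.
  have p_2 : p 0 2%:R * (2 * k) = 0 by lra.
  case/eqP: p0; apply: dot_eq0; rewrite dotE p_1.
  have /eqP -> : p 0 0 == 0 by move/eqP: p_0; rewrite mulf_eq0 (gt_eqF kk0) orbF.
  have /eqP -> : p 0 2%:R == 0.
    by move/eqP: p_2; rewrite mulf_eq0 mulf_eq0 pnatr_eq0 (negbTE kn) !orbF.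
  by rewrite !mul0r !addr0.
pose O := vec 0 0 k.
have OA : sqdist O A = k ^+ 2 + (2 * k ^+ 2) ^+ 2 by rewrite sqdist_vec; ring.
have OB : sqdist O B = k ^+ 2 + (2 * k ^+ 2) ^+ 2 by rewrite sqdist_vec; ring.
have OC : sqdist O C = k ^+ 2 + 1 ^+ 2 by rewrite sqdist_vec; ring.
have OD : sqdist O D = k ^+ 2 + 1 ^+ 2 by rewrite sqdist_vec; ring.
exists O, k; split=> //; split; split.
- exact: tangent_edgeP AB OA OB.
- exact: tangent_edgeP AC OA OC.
- exact: tangent_edgeP AD OA OD.
- exact: tangent_edgeP BC OB OC.
- exact: tangent_edgeP BD OB OD.
- exact: tangent_edgeP CD OC OD.
Qed.

(** The bound on u says that tan u >= 2 sqrt 2, which makes the discriminant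
    tan u ^ 2 - 8 of the quadratic equation for k nonnegative. *)
Lemma atan_family (u : R) : acos (1 / 3) <= u -> u < pi / 2 ->
  exists2 k : R, 0 < k & atan k + atan ((2 * k)^-1) = u.
Proof.
move=> u_ge u_lt.
have third : -1 <= (1 / 3 : R) <= 1 by apply/andP; split; lra.
have u0 : 0 < u.
  apply: lt_le_trans u_ge; apply: acos_gt0; apply/andP; split; lra.
have cosu : 0 < cos u by apply: cos_gt0_pihalf; apply/andP; split; lra.
have sinu : 0 < sin u by apply: sin_gt0_pihalf; rewrite u0.
have cosu_le : cos u <= 1 / 3.
  rewrite -[leRHS](@acosK R) ?in_itv //= leNgt; apply/negP.
  rewrite ltr_cos ?in_itv /= ?acos_ge0 ?acos_lepi //; first lra.
  by have := pi_gt0 R; move=> ?; apply/andP; split; lra.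
pose T := tan u.
have T0 : 0 < T by exact: divr_gt0.
have T8 : 8 <= T ^+ 2.
  have E : T ^+ 2 * cos u ^+ 2 = 1 - cos u ^+ 2.
    by rewrite /T /tan -sin2cos2; field; rewrite gt_eqF.
  rewrite -subr_ge0 -(pmulr_lge0 _ (exprn_gt0 2 cosu)) mulrBl E; nra.
have S2 : Num.sqrt (T ^+ 2 - 8) ^+ 2 = T ^+ 2 - 8.
  by rewrite sqr_sqrtr // subr_ge0.
(* k is the larger root of 2 k^2 - T k + 1, that is, 2 k + 1 / k = T. *)
pose k := (T + Num.sqrt (T ^+ 2 - 8)) / 4.
have k0 : 0 < k by rewrite divr_gt0 // ltr_pwDl // sqrtr_ge0.
have root : 2 * k ^+ 2 + 1 = T * k by rewrite /k; nra.
exists k => //.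
have := atan_gtNpi2 k; have := atan_ltpi2 k => klt kgt.
have ak0 : 0 < atan k by rewrite -(@atan0 R) lt_atan.
suff -> : (2 * k)^-1 = tan (u - atan k).
  by rewrite tanK ?in_itv /=; [ring | apply/andP; split; lra].
rewrite tanD ?cosN ?gt_eqF ?cos_atan_gt0 // tanN atanK -/T.
have TE : T = (2 * k ^+ 2 + 1) / k by rewrite root mulfK // gt_eqF.
have den : k + (2 * k ^+ 2 + 1) * k != 0.
  by rewrite gt_eqF // addr_gt0 // mulr_gt0 // addr_gt0 // mulr_gt0 // exprn_gt0.
by rewrite TE; field; rewrite mulrN opprK den gt_eqF.
Qed.

End FourBallTetrahedra.

Theorem theorem9 (R : realType) :
  (forall A B C D : 'rV[R]_3, is_4ball_tetrahedron A B C D ->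
     6 * acos (1 / 3 : R) <= dihedral_angle_sum A B C D
     /\ dihedral_angle_sum A B C D < 3 * pi)
  /\
  (forall s : R, 6 * acos (1 / 3 : R) <= s -> s < 3 * pi ->
     exists A B C D : 'rV[R]_3,
       is_4ball_tetrahedron A B C D /\ dihedral_angle_sum A B C D = s).
Proof.
split=> [A B C D /dihedral_angle_sum_bounds/andP[] //|s s_ge s_lt].
have [k k0 ks] : exists2 k : R, 0 < k & atan k + atan ((2 * k)^-1) = s / 6.
  by apply: atan_family; lra.
have [ball sumE] := balanced_tetrahedron k0.
by do 4!eexists; split; [exact: ball | rewrite sumE ks; field].
Qed.
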